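(* For every integer $m \ge 2$, $d(m, 3m+1) \le 56$.
   Context: An integral point set in $\mathbb{R}^m$ is a finite set $\mathcal{P}$ of points of the $m$-dimensional Euclidean space $\mathbb{R}^m$ such that the Euclidean distance between any two points of $\mathcal{P}$ is an integer and $\mathcal{P}$ is not contained in an $(m-1)$-dimensional (affine) hyperplane. Its diameter is $\operatorname{diam}(\mathcal{P}) = \max_{P_1, P_2 \in \mathcal{P}} |P_1P_2|$. The function $d(m,n)$ is the minimal possible diameter of an integral point set of $n$ points in $\mathbb{R}^m$. *)

(* Defs.v *)
From HB Require Import structures.
From mathcomp Require Import all_boot all_order all_algebra.
From mathcomp Require Import finmap.
From mathcomp Require Import boolp classical_sets reals constructive_ereal ereal.

Set Implicit Arguments.
Unset Strict Implicit.
Unset Printing Implicit Defensive.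

Import Order.TTheory GRing.Theory Num.Theory.
Local Open Scope ring_scope.

(* The library's norm on ['rV[R]_m] is the sup norm, hence this definition. *)
Definition edist (R : realType) (m : nat) (x y : 'rV[R]_m) : R :=
  Num.sqrt (\sum_(i < m) (x 0 i - y 0 i) ^+ 2).

Definition affine_subspace (R : realType) (m : nat)
    (p : 'rV[R]_m) (U : {vspace 'rV[R]_m}) : set 'rV[R]_m :=
  [set x | x - p \in U]%classic.

Definition hyperplane (R : realType) (m : nat) (H : set 'rV[R]_m) : Prop :=
  exists (p : 'rV[R]_m) (U : {vspace 'rV[R]_m}),
    \dim U = m.-1 /\ H = affine_subspace p U.

Definition integral_point_set (R : realType) (m : nat)
    (P : {fset 'rV[R]_m}) : Prop :=
  {in P &, forall x y, edist x y \is a Num.int} /\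
  forall H : set 'rV[R]_m, hyperplane H -> ~ ([set` P] `<=` H)%classic.

(* Distances are nonnegative, so the default value 0 only matters for the
   empty set. *)
Definition diam (R : realType) (m : nat) (P : {fset 'rV[R]_m}) : R :=
  \big[Num.max/0]_(x <- P) \big[Num.max/0]_(y <- P) edist x y.

(* d(m, n). Extended-real valued, so that it is +oo, and not some finite junk
   value, when there is no integral point set of n points in R^m; otherwise
   the infimum is a minimum, see [min_diam_attained]. *)
Definition min_diam (R : realType) (m n : nat) : \bar R :=
  ereal_inf [set (diam P)%:E | P in
    [set P : {fset 'rV[R]_m} | integral_point_set P /\ #|` P|%fset = n]]%classic.

Lemma diam_nat (R : realType) (m : nat) (P : {fset 'rV[R]_m}) :
  integral_point_set P -> exists k : nat, diam P = k%:R.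
Proof.
move=> [Pint _]; apply/natrP; rewrite /diam.
have max_nat (a b : R) : a \is a Num.nat -> b \is a Num.nat ->
    Num.max a b \is a Num.nat by move=> ? ?; case: leP.
rewrite big_seq; apply: (big_ind (fun a : R => a \is a Num.nat)) => //.
move=> x xP; rewrite big_seq.
apply: (big_ind (fun a : R => a \is a Num.nat)) => // y yP.
by rewrite natrEint Pint //= sqrtr_ge0.
Qed.

Lemma min_diam_attained (R : realType) (m n : nat) :
  (exists P : {fset 'rV[R]_m}, integral_point_set P /\ #|` P|%fset = n) ->
  exists P : {fset 'rV[R]_m},
    [/\ integral_point_set P, #|` P|%fset = n & min_diam R m n = (diam P)%:E].
Proof.
move=> [P0 [P0i P0n]].
pose A k := `[< exists P : {fset 'rV[R]_m},
  [/\ integral_point_set P, #|` P|%fset = n & diam P = k%:R] >].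
have exA : exists k, A k.
  by have [k kP] := diam_nat P0i; exists k; apply/asboolP; exists P0.
case: (ex_minnP exA) => k /asboolP[P [Pi Pn Pk]] kmin.
exists P; split=> //; apply/eqP; rewrite eq_le; apply/andP; split.
  by apply: ereal_inf_lbound; exists P.
apply: le_ereal_inf_tmp => _ [Q [Qi Qn] <-].
have [l Ql] := diam_nat Qi.
rewrite lee_fin Pk Ql ler_nat; apply: kmin; apply/asboolP; by exists Q.
Qed.

(* Main.v *)
Require Import Defs.
From mathcomp Require Import all_boot all_order all_algebra.
From mathcomp Require Import reals constructive_ereal ereal.
From mathcomp Require Import finmap classical_sets ring.

(** Take [m] unit vectors of [R^m] at pairwise angles of 60 degrees, and on each
    of the [m] rays they span the points at distance 7, 15 and 40 from the
    origin. Together with the origin these are [3 * m + 1] points. Two points at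
    distances [a], [b] on different rays are at distance
    [sqrt (a ^ 2 + b ^ 2 - a * b)], and 7, 15, 40 are pairwise sides of integral
    triangles with a 60 degree angle, the third sides being 13, 37 and 35. The
    diameter is 40. *)

Set Implicit Arguments.
Unset Strict Implicit.
Unset Printing Implicit Defensive.

Import Order.TTheory GRing.Theory Num.Theory.
Local Open Scope ring_scope.

Section SixtyDegrees.
Variables (R : realType) (m : nat).
Hypothesis m_gt0 : (0 < m)%N.

(* The positive root of [m * x ^ 2 + 2 * x = 1], so that the vectors
   [e_i + x * (1, ..., 1)] have squared norm 2 and inner products 1. *)
Definition shift : R := (Num.sqrt (m%:R + 1) - 1) / m%:R.

Definition ray (i : 'I_m) : 'rV[R]_m :=
  (Num.sqrt 2)^-1 *: (delta_mx 0 i + const_mx shift).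

Lemma shift_eq : m%:R * shift ^+ 2 + 2 * shift = 1.
Proof.
have m0 : m%:R != 0 :> R by rewrite pnatr_eq0 -lt0n.
have h : Num.sqrt (m%:R + 1) ^+ 2 = m%:R + 1 :> R by rewrite sqr_sqrtr ?addr_ge0.
rewrite /shift; set s := Num.sqrt _ in h *.
transitivity ((s ^+ 2 - 1) / m%:R); first by field.
by rewrite h addrK divff.
Qed.

Lemma shift_ge0 : 0 <= shift.
Proof.
by rewrite divr_ge0 // subr_ge0 -[leLHS]sqrtr1 ler_wsqrtr // lerDr.
Qed.

Lemma dot_ray (i j : 'I_m) :
  \sum_l ray i 0 l * ray j 0 l = if i == j then 1 else 2^-1.
Proof.
have h2 : (Num.sqrt 2)^-1 ^+ 2 = 2^-1 :> R by rewrite exprVn sqr_sqrtr.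
have sum_delta (k : 'I_m) (F : 'I_m -> R) : \sum_l (l == k)%:R * F l = F k.
  rewrite (bigD1 k) //= eqxx mul1r big1 ?addr0 // => l /negbTE->.
  by rewrite mul0r.
(* The sum comes to [(i == j) + 2 * shift + m * shift ^ 2], which [shift_eq] turns into
   [(i == j) + 1]. *)
transitivity (2^-1 * \sum_l ((l == i)%:R * ((l == j)%:R + shift) +
    (l == j)%:R * shift + shift ^+ 2)).
  by rewrite mulr_sumr; apply: eq_bigr => l _; rewrite !mxE /= -h2; ring.
rewrite !big_split /= !sum_delta sumr_const card_ord -(mulr_natl _ m) -addrA -addrA.
have -> : shift + (shift + m%:R * shift ^+ 2) = 1 by rewrite -[RHS]shift_eq; ring.
by case: eqP => _ /=; field.
Qed.

(** The vectors [e_i + shift * (1, ..., 1)] add up to a positive multiple of [(1, ..., 1)]. So [U]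
    contains the constant vector, and by subtraction every [e_i]. *)
Lemma rays_span (U : {vspace 'rV[R]_m}) :
  (forall i, ray i \in U) -> U = fullv.
Proof.
move=> rayU.
have s2 : Num.sqrt 2 != 0 :> R by rewrite sqrtr_eq0 -ltNge.
have sumU i : delta_mx 0 i + const_mx shift \in U.
  have := memvZ (Num.sqrt 2) (rayU i).
  by rewrite scalerA mulfV // scale1r.
have shiftU : const_mx shift \in U.
  have c0 : 1 + m%:R * shift != 0.
    by rewrite gt_eqF // ltr_pwDl // mulr_ge0 ?shift_ge0.
  have -> : const_mx shift = (shift / (1 + m%:R * shift)) *:
      \sum_i (delta_mx 0 i + const_mx shift) :> 'rV[R]_m.
    apply/rowP => l; rewrite !(mxE, summxE).
    under eq_bigr => i _ do rewrite !mxE /=.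
    rewrite big_split /= sumr_const card_ord (bigD1 l) //= eqxx.
    rewrite big1 ?addr0 => [|i /negbTE il]; last by rewrite eq_sym il.
    by rewrite -[shift *+ m]mulr_natl divfK.
  by apply: memvZ; apply: memv_suml.
apply/vspaceP => v; rewrite memvf (row_sum_delta v).
apply: memv_suml => i _; apply: memvZ.
by have := memvB (sumU i) shiftU; rewrite addrK.
Qed.

End SixtyDegrees.

Definition radius (k : 'I_3) : nat := nth 0%N [:: 7; 15; 40] k.

(** The diagonal belongs to equilateral triangles: equal radii on different rays. *)
Definition third_side (k l : 'I_3) : nat :=
  nth 0%N (nth [::] [:: [:: 7; 13; 37]; [:: 13; 15; 35]; [:: 37; 35; 40]] k) l.

(** The law of cosines at 60 degrees, rearranged to avoid truncated subtraction; nine numerical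
    cases. *)
Lemma third_side_eq (k l : 'I_3) :
  (third_side k l ^ 2 + radius k * radius l = radius k ^ 2 + radius l ^ 2)%N.
Proof. by case: k l => [[|[|[|k]]] // ?] [[|[|[|l]]] // ?]. Qed.

Section Configuration.
Variables (R : realType) (m : nat).
Hypothesis m_gt0 : (0 < m)%N.

Definition point (a : option ('I_m * 'I_3)) : 'rV[R]_m :=
  if a is Some (i, k) then (radius k)%:R *: ray R i else 0.

(** On a common ray, at least one of the two truncated differences is 0, so their sum is the
    absolute difference of the radii. *)
Definition point_dist (a b : option ('I_m * 'I_3)) : nat :=
  match a, b with
  | None, None => 0%N
  | None, Some (_, k) | Some (_, k), None => radius k
  | Some (i, k), Some (j, l) =>
      if i == j then ((radius k - radius l) + (radius l - radius k))%N
      else third_side k l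
  end.

(** Expanding the squared norm leaves only the inner products given by [dot_ray]: 1 on a common ray,
    where the radicand is [(a - b) ^ 2], and 1/2 otherwise. *)
Lemma edist_ray (i j : 'I_m) (a b : R) :
  edist (a *: ray R i) (b *: ray R j) =
    Num.sqrt (a ^+ 2 + b ^+ 2 - (if i == j then 2 else 1) * (a * b)).
Proof.
rewrite /edist; congr Num.sqrt.
transitivity (a ^+ 2 * (\sum_l ray R i 0 l * ray R i 0 l) +
   b ^+ 2 * (\sum_l ray R j 0 l * ray R j 0 l) -
   2 * (a * b) * (\sum_l ray R i 0 l * ray R j 0 l)).
  rewrite !mulr_sumr -big_split -sumrB; apply: eq_bigr => l _.
  by rewrite !mxE /=; ring.
by rewrite !dot_ray // !eqxx; case: eqP => _; field.
Qed.

Lemma edist_point a b : edist (point a) (point b) = (point_dist a b)%:R.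
Proof.
have sqrtE (x : R) (n : nat) : x = n%:R ^+ 2 -> Num.sqrt x = n%:R.
  by move=> ->; rewrite sqrtr_sqr ger0_norm.
case: a b => [[i k]|] [[j l]|] /=.
- rewrite edist_ray; apply: sqrtE; apply/eqP.
  case: (i =P j) => _; rewrite ?mul1r subr_eq -!natrX -!natrM -!natrD eqr_nat.
    by case: k l => [[|[|[|k]]] // ?] [[|[|[|l]]] // ?].
  by rewrite third_side_eq.
(* The origin is written as 0 times a ray, so that [edist_ray] covers it too. *)
- rewrite -(scale0r (ray R i)) edist_ray eqxx; apply: sqrtE; ring.
- rewrite -(scale0r (ray R j)) edist_ray eqxx; apply: sqrtE; ring.
- rewrite -(scale0r (ray R (Ordinal m_gt0))) edist_ray; apply: sqrtE; ring.
Qed.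

Lemma point_dist_le a b : (point_dist a b <= 40)%N.
Proof.
by case: a b => [[i [[|[|[|k]]] // ?]]|] [[j [[|[|[|l]]] // ?]]|] //=; case: eqP.
Qed.

Lemma point_dist_eq0 a b : point_dist a b = 0%N -> a = b.
Proof.
case: a b => [[i k]|] [[j l]|] //=; last first.
- by case: l => [[|[|[|l]]] // ?].
- by case: k => [[|[|[|k]]] // ?].
case: eqP => [->|_]; last by case: k l => [[|[|[|k]]] // ?] [[|[|[|l]]] // ?].
by case: k l => [[|[|[|k]]] // ?] [[|[|[|l]]] // ?] //= _;
  congr (Some (_, _)); apply: val_inj.
Qed.

(** Distinct labels have nonzero [point_dist], hence their points are at nonzero distance. *)
Lemma point_inj : injective point.
Proof.
move=> a b ab; apply: point_dist_eq0; apply/eqP.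
rewrite -(eqr_nat R) -edist_point ab edist_point eqr_nat.
by case: b {ab} => [[i k]|] //=; rewrite eqxx subnn.
Qed.

Definition configuration : {fset 'rV[R]_m} :=
  [fset point a | a : option ('I_m * 'I_3)]%fset.

Lemma card_configuration : #|` configuration|%fset = (3 * m + 1)%N.
Proof.
rewrite card_imfset /=; last exact: point_inj.
by rewrite -cardT card_option card_prod !card_ord mulnC addn1.
Qed.

Lemma integral_configuration : integral_point_set configuration.
Proof.
split=> [x y /imfsetP[a _ ->] /imfsetP[b _ ->]|_ [p [U [dimU ->]]] sub].
  by rewrite edist_point.
have inP a : point a - p \in U.
  by apply: (sub (point a)); apply/imfsetP; exists a.
have Ufull : U = fullv.
  apply: rays_span => i.
  (* Subtracting the origin from the point at radius 7 cancels the base point [p]; dividing by 7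
     leaves the ray. *)
  have := memvB (inP (Some (i, ord0))) (inP None).
  rewrite /= opprB addrA subrK subr0 => /(memvZ (7%:R)^-1).
  by rewrite scalerA mulVf ?pnatr_eq0 // scale1r.
(* The full space has dimension [m], which differs from [m.-1] since [m] is positive. *)
by move: dimU; rewrite Ufull dimvf /dim /= mul1n => /eqP; rewrite gtn_eqF ?ltn_predL.
Qed.

Lemma diam_configuration : diam configuration <= 40.
Proof.
rewrite /diam big_seq; apply: (big_ind (fun v : R => v <= 40)) => // [x y|x /imfsetP[a _ ->]].
  by rewrite ge_max => -> ->.
rewrite big_seq; apply: (big_ind (fun v : R => v <= 40)) => // [x' y|y /imfsetP[b _ ->]].
  by rewrite ge_max => -> ->.
by rewrite edist_point ler_nat point_dist_le.
Qed.

End Configuration.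

Theorem mainTheorem5 (R : realType) (m : nat) (hm : (2 <= m)%N) :
  (min_diam R m (3 * m + 1)%N <= (56%:R)%:E)%E.
Proof.
have m_gt0 : (0 < m)%N by apply: leq_trans hm.
apply: (@le_trans _ _ (diam (configuration R m))%:E).
  apply: ereal_inf_lbound; exists (configuration R m) => //.
  by split; [exact: integral_configuration | exact: card_configuration].
by rewrite lee_fin (le_trans (diam_configuration R m_gt0)) // ler_nat.
Qed.
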